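(* $$\lim_{k\to\infty}\sigma(k\text{-Set Cover}/n)\le\lim_{k\to\infty}\sigma(k\text{-Set Cover}/(n+t)).$$
   Context: $k$-Set Cover: given an integer $t$ and $\mathcal F\subseteq 2^U$ with $|U|=n$, $|\mathcal F|=m$, every set of size at most $k$, decide whether there is $\mathcal C\subseteq\mathcal F$ with $|\mathcal C|\le t$ and $\bigcup_{S\in\mathcal C}S=U$. For a problem $\Pi$ with input size $m$ and a numerical parameter $p$ of the instance, $\sigma(\Pi/p)$ is the infimum of all $\epsilon>0$ such that $\Pi$ has a randomized algorithm with error probability at most $1/3$ running in time $2^{\epsilon p}\mathrm{poly}(m)$; here $p=n$ or $p=n+t$. *)

(* Defs.v *)
From Corelib Require Import BinNums.
From mathcomp Require Import all_boot all_order all_algebra.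
From mathcomp Require Import all_classical all_reals all_analysis.

Set Implicit Arguments.
Unset Strict Implicit.
Unset Printing Implicit Defensive.

Import Order.TTheory GRing.Theory Num.Theory.
Import numFieldNormedType.Exports.

Local Open Scope ring_scope.

(*  The machine model is Jones's WHILE language (Computability and Complexity
    from a Programming Perspective, 1997) with a coin-flipping instruction: a
    program has finitely many variables, each holding a binary tree, and every
    executed instruction or test costs one step.  Operands are variables, so
    that a step is a bounded number of pointer operations on shared immutable
    cells.  Conversely T steps of a RAM (with words of O(log T) bits) take
    T polylog(T) steps here, the memory being kept in a balanced tree.  For
    T = 2^(eps p) poly(m), a factor polylog(T) is at most
    2^(delta p) poly(m) for every delta > 0, so the infimum [sigma] below is
    the same as for RAMs. *)

Inductive tree := Leaf | Node (l r : tree).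

Fixpoint tree_size (x : tree) : nat :=
  if x is Node l r then (tree_size l + tree_size r).+1 else 1%N.

Definition is_node (x : tree) : bool := if x is Node _ _ then true else false.
Definition hd (x : tree) : tree := if x is Node l _ then l else Leaf.
Definition tl (x : tree) : tree := if x is Node _ r then r else Leaf.

Definition var := nat.
Definition store := var -> tree.

Inductive expr :=
  | ELeaf
  | EVar of var
  | ENode of var & var
  | EHd of var
  | ETl of var.

Definition eval (s : store) (e : expr) : tree :=
  match e with
  | ELeaf => Leaf
  | EVar x => s x
  | ENode x y => Node (s x) (s y)
  | EHd x => hd (s x)
  | ETl x => tl (s x)
  end.

(* A leaf is "false" in tests, a node is "true". *)
Inductive instr :=
  | Assign of var & expr
  | Flip of var
  | If of var & seq instr & seq instr
  | While of var & seq instr.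

Definition prog := seq instr.

Definition update (s : store) (x : var) (v : tree) : store :=
  fun y => if y == x then v else s y.

Definition enc_bool (b : bool) : tree := if b then Node Leaf Leaf else Leaf.

(* The instructions that remain to be executed, and the store. *)
Definition config := (prog * store)%type.

(* One step; [b] is a fresh coin, which only [Flip] looks at. *)
Definition step (c : config) (b : bool) : config :=
  let: (p, s) := c in
  if p is i :: k then
    match i with
    | Assign x e => (k, update s x (eval s e))
    | Flip x => (k, update s x (enc_bool b))
    | If x p1 p2 => ((if is_node (s x) then p1 else p2) ++ k, s)
    | While x p1 => (if is_node (s x) then p1 ++ p else k, s)
    end
  else c.

(* The input is read from, and the answer left in, variable 0. *)
Definition init (p : prog) (x : tree) : config :=
  (p, update (fun=> Leaf) 0%N x).

(* [size r] steps, the i-th of them with the i-th element of [r] as coin. *)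
Definition run (p : prog) (x : tree) (r : seq bool) : config :=
  foldl step (init p x) r.

Definition halted (c : config) : bool := nilp c.1.
Definition answer (c : config) : bool := is_node (c.2 0%N).

Definition halts_within (p : prog) (x : tree) (T : nat) : Prop :=
  forall r : T.-tuple bool, halted (run p x r).

(* When [halts_within p x T], this does not depend on [T]. *)
Definition error_prob (R : realType) (p : prog) (x : tree) (T : nat)
    (b : bool) : R :=
  #|[set r : T.-tuple bool | answer (run p x r) != b]|%:R
    / #|{: T.-tuple bool}|%:R.

Record problem := Problem {
  instance : Type;
  encode : instance -> tree;
  yes : instance -> bool }.

Definition input_size (Pi : problem) (I : instance Pi) : nat :=
  tree_size (encode I).

Definition solvable_in (R : realType) (Pi : problem)
    (par : instance Pi -> nat) (eps : R) : Prop :=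
  exists (A : prog) (q : {poly nat}), forall I : instance Pi,
    exists T : nat,
      [/\ T%:R <= 2 `^ (eps * (par I)%:R) * (q.[input_size I])%:R,
          halts_within A (encode I) T
        & error_prob R A (encode I) T (yes I) <= 3^-1].

(* An extended real: +oo when no [eps] is suitable. *)
Definition sigma (R : realType) (Pi : problem) (par : instance Pi -> nat) :
    \bar R :=
  ereal_inf [set eps%:E | eps in
    [set eps : R | 0 < eps /\ solvable_in par eps]]%classic.

(* The universe is {0, ..., n-1}; the family is listed in an arbitrary order,
   without repetition. *)
Record set_cover_instance (k : nat) := SetCoverInstance {
  sc_n : nat;
  sc_family : seq {set 'I_sc_n};
  sc_t : nat;
  sc_uniq : uniq sc_family;
  sc_small : all (fun S : {set 'I_sc_n} => #|S| <= k)%N sc_family }.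

Definition has_cover (k : nat) (I : set_cover_instance k) : bool :=
  [exists C : {set {set 'I_(sc_n I)}},
    [&& C \subset sc_family I,
        (#|C| <= sc_t I)%N
      & finset.cover C == [set: 'I_(sc_n I)]]].

Definition enc_seq : seq tree -> tree := foldr Node Leaf.

(* Little-endian binary; the empty list for 0. *)
Fixpoint enc_pos (p : positive) : tree :=
  match p with
  | xH => Node (enc_bool true) Leaf
  | xO p' => Node (enc_bool false) (enc_pos p')
  | xI p' => Node (enc_bool true) (enc_pos p')
  end.

Definition enc_nat (n : nat) : tree :=
  if bin_of_nat n is Npos p then enc_pos p else Leaf.

Definition enc_set (n : nat) (S : {set 'I_n}) : tree :=
  enc_seq [seq enc_bool (i \in S) | i <- enum 'I_n].

(* The universe (a list of n leaves), the incidence vectors of the members of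
   the family, and t in binary: the size of this tree is polynomially related
   to n + |F| + log t. *)
Definition enc_set_cover (k : nat) (I : set_cover_instance k) : tree :=
  Node (enc_seq (nseq (sc_n I) Leaf))
    (Node (enc_seq [seq enc_set B | B <- sc_family I])
      (enc_nat (sc_t I))).

Definition set_cover (k : nat) : problem :=
  @Problem (set_cover_instance k) (@enc_set_cover k) (@has_cover k).

Definition par_n (k : nat) (I : instance (set_cover k)) : nat := sc_n I.

Definition par_nt (k : nat) (I : instance (set_cover k)) : nat :=
  (sc_n I + sc_t I)%N.

Definition widen_instance (k l : nat) (kl : (k <= l)%N)
    (I : set_cover_instance k) : set_cover_instance l :=
  SetCoverInstance (sc_t I) (sc_uniq I)
    (sub_all (fun (B : {set _}) (Bk : (#|B| <= k)%N) => leq_trans Bk kl) (sc_small I)).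

Lemma sigma_widen (R : realType) (par : forall k, instance (set_cover k) -> nat)
    (k l : nat) (kl : (k <= l)%N) :
  (forall I, par l (widen_instance kl I) = par k I) ->
  (sigma R (par k) <= sigma R (par l))%E.
Proof.
move=> parE; apply: ereal_inf_le_tmp => _ [eps [eps0 [A [q Aq]]] <-].
exists eps => //; split => //; exists A, q => I.
by have := Aq (widen_instance kl I); rewrite parE.
Qed.

(* The two sequences are nondecreasing in k, so their [lim] is a limit. *)
Lemma is_cvg_sigma_n (R : realType) : cvgn (fun k => sigma R (@par_n k)).
Proof.
by apply: ereal_nondecreasing_is_cvgn => k l kl; exact: (@sigma_widen R par_n k l kl (fun=> erefl)).
Qed.

Lemma is_cvg_sigma_nt (R : realType) : cvgn (fun k => sigma R (@par_nt k)).
Proof.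
by apply: ereal_nondecreasing_is_cvgn => k l kl; exact: (@sigma_widen R par_nt k l kl (fun=> erefl)).
Qed.

(* Main.v *)
(* Replacing the family by the unions of at most q = 2^j of its members divides
   the budget t by q, multiplies the size of the sets by q, and preserves the
   answer when q divides t.  Moreover t may be assumed to be at most n.  Hence an
   algorithm running in time 2^(eps (n + t)) for sets of size at most qk yields
   one running in time 2^(eps (1 + 1/q) n + O(1)) for sets of size at most k, and
   q can be taken arbitrarily large.

   The unions are formed by j rounds of pairwise unions.  Each round halves t;
   if t is odd, it is first made even by adding to the instance a new element
   together with its singleton. *)

Require Import Defs.
From mathcomp Require Import all_boot all_order all_algebra.
From mathcomp Require Import all_classical all_reals all_analysis.
From mathcomp Require Import zify ring.

Set Implicit Arguments.
Unset Strict Implicit.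
Unset Printing Implicit Defensive.

Import Order.TTheory GRing.Theory Num.Theory.

Local Open Scope nat_scope.

(** * Elementary bounds on sizes and polynomials *)

Lemma tree_size_gt0 x : 0 < tree_size x.
Proof. by case: x. Qed.

Lemma tree_size_hd x : tree_size (hd x) <= tree_size x.
Proof. by case: x => //= l r; lia. Qed.

Lemma tree_size_tl x : tree_size (tl x) <= tree_size x.
Proof. by case: x => //= l r; lia. Qed.

(** Coefficients in [nat] are nonnegative; monotonicity is what lets time and size bounds be
    composed. *)
Lemma horner_nat_le (p : {poly nat}) (m n : nat) : m <= n -> p.[m]%R <= p.[n]%R.
Proof.
move=> mn; rewrite !horner_coef; apply: leq_sum => i _.
rewrite leq_mul2l; apply/orP; right.
by elim: (i : nat) => // j IHj; rewrite !exprS; exact: leq_mul.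
Qed.

(** * Execution of program fragments *)

(** The number [T] of steps depends neither on the coins nor on the continuation [k]. Hence a
    fragment consumes a prefix of fixed length of the coin sequence, and fragments can be
    concatenated. *)
Definition exec (p : prog) (s s' : store) (b : nat) : Prop :=
  exists2 T, T <= b & forall (k : prog) (r : seq bool),
    seq.size r = T -> foldl step (p ++ k, s) r = (k, s').

Lemma exec_le p s s' b b' : b <= b' -> exec p s s' b -> exec p s s' b'.
Proof. by move=> bb' [T Tb H]; exists T => //; exact: leq_trans bb'. Qed.

Lemma exec_nil s b : exec [::] s s b.
Proof. by exists 0 => // k r /size0nil->. Qed.

Lemma exec_cat p1 p2 s1 s2 s3 b1 b2 :
  exec p1 s1 s2 b1 -> exec p2 s2 s3 b2 -> exec (p1 ++ p2) s1 s3 (b1 + b2).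
Proof.
move=> [T1 le1 H1] [T2 le2 H2]; exists (T1 + T2); first exact: leq_add.
move=> k r rT; rewrite -(cat_take_drop T1 r) foldl_cat -catA H1.
  by rewrite H2 // size_drop rT addKn.
by rewrite size_takel // rT leq_addr.
Qed.

Lemma exec_step i p s s1 s' b p1 :
  (forall k c, step (i :: p ++ k, s) c = (p1 ++ k, s1)) ->
  exec p1 s1 s' b -> exec (i :: p) s s' b.+1.
Proof.
move=> H [T Tb E]; exists T.+1 => // k [//|c r] [rT] /=.
by have /= -> := H k c; exact: E.
Qed.

Lemma exec_assign x e p s s' b :
  exec p (update s x (Defs.eval s e)) s' b -> exec (Assign x e :: p) s s' b.+1.
Proof. exact: exec_step. Qed.

Lemma exec_if x p1 p2 p s s' b :
  exec ((if is_node (s x) then p1 else p2) ++ p) s s' b ->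
  exec (If x p1 p2 :: p) s s' b.+1.
Proof. by apply: exec_step => k c /=; rewrite catA. Qed.

Lemma exec_while_false x p1 p s s' b :
  is_node (s x) = false -> exec p s s' b -> exec (While x p1 :: p) s s' b.+1.
Proof. by move=> sx; apply: exec_step => k c /=; rewrite sx. Qed.

Lemma exec_while_true x p1 p s s' b :
  is_node (s x) -> exec (p1 ++ While x p1 :: p) s s' b ->
  exec (While x p1 :: p) s s' b.+1.
Proof. by move=> sx; apply: exec_step => k c /=; rewrite sx -catA. Qed.

(** * Polynomial-time functions on trees *)

(* The variables form a stack: [P d] replaces the content of [d], and uses the
   variables above [d], which must be and are left clear, as scratch space. *)
Definition computes (P : var -> prog) (f : tree -> tree) (b : nat -> nat) :=
  forall d s, (forall y, d < y -> s y = Leaf) ->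
    exec (P d) s (update s d (f (s d))) (b (tree_size (s d))).

(* The size bound does not follow from the time bound: iterating
   [x := Node x x] produces shared trees of exponential size. *)
Definition polytime (f : tree -> tree) : Prop :=
  exists (P : var -> prog) (q : {poly nat}),
    computes P f (horner q) /\ forall x, tree_size (f x) <= q.[tree_size x]%R.

Lemma polytime_intro P f (b : nat -> nat) (q q' : {poly nat}) :
  computes P f b -> (forall n, b n <= q.[n]%R) ->
  (forall x, tree_size (f x) <= q'.[tree_size x]%R) -> polytime f.
Proof.
move=> cP bq fq; exists P, (q + q')%R; split => [d s sd|x]; rewrite hornerD.
  by apply: exec_le (cP d s sd); apply: leq_trans (bq _) (leq_addr _ _).
by apply: leq_trans (fq x) (leq_addl _ _).
Qed.

Ltac store_eq := apply/funext => y; rewrite /Defs.eval /update /=;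
  repeat (case: eqP => ? /=; subst => //=; try lia); rewrite /=.

Ltac simpl_store := rewrite /Defs.eval /update /= ?eqxx;
  repeat match goal with |- context [?a == ?b] =>
    first [ have -> : (a == b) = false by apply/eqP; lia
          | have -> : (a == b) = true by apply/eqP; lia ] end.

Lemma polytime_id : polytime (fun x => x).
Proof.
apply: (@polytime_intro (fun=> [::]) _ (fun=> 0) 0%R 'X%R) => // [d s sd|x].
  have -> : update s d (s d) = s by store_eq.
  exact: exec_nil.
by rewrite hornerX.
Qed.

Lemma polytime_leaf : polytime (fun=> Leaf).
Proof.
apply: (@polytime_intro (fun d => [:: Assign d ELeaf]) _ (fun=> 1) 1%R 1%R).
- by move=> d s sd; apply: exec_assign; exact: exec_nil.
- by move=> n; rewrite hornerC.
- by move=> x; rewrite hornerC.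
Qed.

Lemma polytime_comp f g : polytime f -> polytime g -> polytime (fun x => f (g x)).
Proof.
move=> [P [p [cP fp]]] [Q [q [cQ gq]]].
apply: (@polytime_intro (fun d => Q d ++ P d) _
  (fun n => q.[n]%R + p.[q.[n]]%R) (q + (p \Po q))%R (p \Po q)%R).
- move=> d s sd; apply: (@exec_cat _ _ _ (update s d (g (s d)))); first exact: cQ.
  have E : update s d (g (s d)) d = g (s d) by simpl_store.
  have -> : update s d (f (g (s d)))
     = update (update s d (g (s d))) d (f (update s d (g (s d)) d)).
    by rewrite E; store_eq.
  apply: (@exec_le _ _ _ p.[tree_size (update s d (g (s d)) d)]%R).
    by apply: horner_nat_le; rewrite E.
  by apply: cP => y dy; rewrite /update gtn_eqF // sd.
- by move=> n; rewrite hornerD horner_comp.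
- by move=> x; rewrite horner_comp; apply: leq_trans (fp _) (horner_nat_le _ (gq x)).
Qed.

Lemma polytime_hd f : polytime f -> polytime (fun x => hd (f x)).
Proof.
apply: polytime_comp.
apply: (@polytime_intro (fun d => [:: Assign d (EHd d)]) _ (fun=> 1) 1%R 'X%R).
- by move=> d s sd; apply: exec_assign; exact: exec_nil.
- by move=> n; rewrite hornerC.
- by move=> x; rewrite hornerX tree_size_hd.
Qed.

Lemma polytime_tl f : polytime f -> polytime (fun x => tl (f x)).
Proof.
apply: polytime_comp.
apply: (@polytime_intro (fun d => [:: Assign d (ETl d)]) _ (fun=> 1) 1%R 'X%R).
- by move=> d s sd; apply: exec_assign; exact: exec_nil.
- by move=> n; rewrite hornerC.
- by move=> x; rewrite hornerX tree_size_tl.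
Qed.

Lemma exec_computes P f b d s s' p c x :
  computes P f b -> (forall y, d < y -> s y = Leaf) -> s d = x ->
  exec p (update s d (f x)) s' c ->
  exec (P d ++ p) s s' (b (tree_size x) + c).
Proof. by move=> cP sd <-; apply: exec_cat; exact: cP. Qed.

Lemma polytime_node f g :
  polytime f -> polytime g -> polytime (fun x => Node (f x) (g x)).
Proof.
move=> [P [p [cP fp]]] [Q [q [cQ gq]]].
(* The input stays in [d] until both results are known: [f] is computed on a copy in [d.+1], then
   [g] on a copy in [d.+2], above the first result. *)
apply: (@polytime_intro (fun d => Assign d.+1 (EVar d) ::
    P d.+1 ++ Assign d.+2 (EVar d) :: Q d.+2 ++
    [:: Assign d (ENode d.+1 d.+2); Assign d.+1 ELeaf; Assign d.+2 ELeaf]) _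
  (fun n => (p.[n]%R + (q.[n]%R + 3).+1).+1)
  (p + q + 5%:P)%R (p + q + 1)%R).
- move=> d s sd; apply: exec_assign.
  apply: exec_computes cP _ _ _;
    [by move=> y dy; simpl_store; apply: sd; lia | by simpl_store |].
  apply: exec_assign.
  apply: exec_computes cQ _ _ _;
    [by move=> y dy; simpl_store; apply: sd; lia | by simpl_store |].
  do 3 apply: exec_assign.
  set s1 := update _ _ _.
  have -> : update s d (Node (f (s d)) (g (s d))) = s1.
    by rewrite /s1; store_eq; rewrite ?sd //; simpl_store.
  exact: exec_nil.
- move=> n; rewrite !hornerD hornerC /=.
  by change (p.[n] + q.[n] + 5)%R with ((p.[n]%R + q.[n]%R) + 5); lia.
- by move=> x; rewrite !hornerD hornerC /=; move: (fp x) (gq x); lia.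
Qed.

Lemma polytime_if c f g : polytime c -> polytime f -> polytime g ->
  polytime (fun x => if is_node (c x) then f x else g x).
Proof.
move=> [C [r [cC cr]]] [P [p [cP fp]]] [Q [q [cQ gq]]].
(* The value of the test sits in [d.+1]; each branch clears it first, since [P d] and [Q d] expect
   everything above [d] to be clear. *)
apply: (@polytime_intro (fun d => Assign d.+1 (EVar d) :: C d.+1 ++
    [:: If d.+1 (Assign d.+1 ELeaf :: P d) (Assign d.+1 ELeaf :: Q d)]) _
  (fun n => (r.[n]%R + (p.[n]%R + q.[n]%R).+2).+1)
  (r + (p + q) + 3%:P)%R (p + q)%R).
- move=> d s sd; apply: exec_assign.
  apply: exec_computes cC _ _ _;
    [by move=> y dy; simpl_store; apply: sd; lia | by simpl_store |].
  apply: exec_if; rewrite cats0.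
  have -> : update (update s d.+1 (Defs.eval s (EVar d))) d.+1 (c (s d)) d.+1 = c (s d)
    by simpl_store.
  case: ifP => _; apply: exec_assign.
  + rewrite -[P d]cats0; apply: exec_le (leq_addr _ _) _; rewrite -[p.[_]%R]addn0.
    apply: exec_computes cP _ _ _;
      [by move=> y dy; simpl_store; case: eqP => // _; apply: sd; lia | by simpl_store |].
    set s1 := update _ _ (f _).
    have -> : update s d (f (s d)) = s1 by rewrite /s1; store_eq; rewrite ?sd //; lia.
    exact: exec_nil.
  + rewrite -[Q d]cats0; apply: exec_le (leq_addl _ _) _; rewrite -[q.[_]%R]addn0.
    apply: exec_computes cQ _ _ _;
      [by move=> y dy; simpl_store; case: eqP => // _; apply: sd; lia | by simpl_store |].
    set s1 := update _ _ (g _).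
    have -> : update s d (g (s d)) = s1 by rewrite /s1; store_eq; rewrite ?sd //; lia.
    exact: exec_nil.
- move=> n; rewrite !hornerD hornerC.
  change (r.[n] + (p.[n] + q.[n]) + 3)%R with (r.[n]%R + (p.[n]%R + q.[n]%R) + 3).
  by lia.
- move=> x; rewrite hornerD; case: ifP => _.
    exact: leq_trans (fp _) (leq_addr _ _).
  exact: leq_trans (gq _) (leq_addl _ _).
Qed.

(** The number [j] of rounds is fixed in advance, so the polynomial may depend on it. *)
Lemma polytime_iter f j : polytime f -> polytime (iter j f).
Proof.
move=> pf; elim: j => [|j IHj]; first exact: polytime_id.
exact: (polytime_comp pf IHj).
Qed.

(* The step function [g] receives the context, the accumulator and the current
   element, packed in one tree. *)
Fixpoint foldt (g : tree -> tree) (c a l : tree) : tree :=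
  if l is Node e l' then foldt g c (g (Node c (Node a e))) l' else a.

Lemma foldt_enc_seq g c a l :
  foldt g c a (enc_seq l) = foldl (fun a e => g (Node c (Node a e))) a l.
Proof. by elim: l a => //= e l IHl a. Qed.

(** One step enlarges the accumulator by an amount that depends only on the context and the element,
    not on the accumulator itself. The growth is therefore additive over the loop instead of
    exponential. *)
Lemma tree_size_foldt g c a l (B : {poly nat}) N :
  (forall a e, tree_size (g (Node c (Node a e)))
     <= tree_size a + B.[(tree_size c + tree_size e)%N]%R) ->
  tree_size c + tree_size l <= N ->
  tree_size (foldt g c a l) <= tree_size a + tree_size l * B.[N]%R.
Proof.
move=> gB; elim: l a => [|e _ l' IHl] a /= lN; first exact: leq_addr.
have {}/IHl /leq_trans : tree_size c + tree_size l' <= N by lia.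
move=> /(_ (g (Node c (Node a e)))); apply.
have := gB a e; have : tree_size c + tree_size e <= N by lia.
by move=> /(horner_nat_le B); rewrite /= mulSn mulnDl; nia.
Qed.

(** Layout of the loop: the context in [d], the accumulator in [d.+1], the remaining list in [d.+2],
    and the argument and result of [G] in [d.+3]. *)
Definition fold_body (G : var -> prog) (d : var) : prog :=
  [:: Assign d.+3 (EHd d.+2); Assign d.+3 (ENode d.+1 d.+3);
      Assign d.+3 (ENode d d.+3)] ++ G d.+3 ++
  [:: Assign d.+1 (EVar d.+3); Assign d.+3 ELeaf; Assign d.+2 (ETl d.+2)].

Definition fold_store (s : store) (d : var) (c a l : tree) : store :=
  update (update (update s d c) d.+1 a) d.+2 l.

(** The bound by [M] is a loop invariant: an iteration adds at most [B.[N]] to the accumulator and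
    shortens the list. It keeps every packed argument of [g] below size [M]. The 7 counts the loop
    test and the six assignments of the body. *)
Lemma exec_fold G g (q B : {poly nat}) d s c a l N M :
  computes G g (horner q) ->
  (forall a e, tree_size (g (Node c (Node a e)))
     <= tree_size a + B.[(tree_size c + tree_size e)%N]%R) ->
  (forall y, d < y -> s y = Leaf) ->
  tree_size c + tree_size l <= N ->
  2 + N + tree_size a + tree_size l * B.[N]%R <= M ->
  exec [:: While d.+2 (fold_body G d)] (fold_store s d c a l)
    (fold_store s d c (foldt g c a l) Leaf) (tree_size l * (q.[M]%R + 7)).+1.
Proof.
move=> cG gB sd; elim: l a => [|e _ l' IHl] a lN aM.
  apply: exec_while_false; last exact: exec_nil.
  by rewrite /fold_store; simpl_store.
have eN : tree_size c + tree_size e <= N by move: lN => /=; lia.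
have gM : tree_size (g (Node c (Node a e))) <= tree_size a + B.[N]%R.
  by apply: leq_trans (gB a e) _; rewrite leq_add2l horner_nat_le.
have T : 3 + (q.[M]%R + 3) + (tree_size l' * (q.[M]%R + 7)).+1
    <= tree_size (Node e l') * (q.[M]%R + 7).
  by rewrite /= mulSn mulnDl; nia.
apply: (@exec_le _ _ _ (3 + (q.[M]%R + 3) + (tree_size l' * (q.[M]%R + 7)).+1).+1) => //.
apply: exec_while_true; first by rewrite /fold_store; simpl_store.
rewrite /fold_body -catA -!addnA; do 3 apply: exec_assign.
rewrite /= -catA.
have nM : tree_size (Node c (Node a e)) <= M by move: lN aM => /=; nia.
apply: (@exec_le _ _ _ (q.[tree_size (Node c (Node a e))]%R
  + (3 + (tree_size l' * (q.[M]%R + 7)).+1))).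
  by rewrite leq_add2r horner_nat_le.
apply: exec_computes cG _ _ _;
  [ by move=> y dy; rewrite /fold_store; simpl_store; apply: sd; lia
  | by rewrite /fold_store; simpl_store |].
do 3 apply: exec_assign; rewrite /=.
set s1 := update _ d.+2 _.
have -> : s1 = fold_store s d c (g (Node c (Node a e))) l'.
  by rewrite /s1 /fold_store; store_eq; rewrite ?sd //; lia.
apply: IHl; first by move: lN => /=; lia.
by move: aM; rewrite /= mulSn mulnDl; nia.
Qed.

Lemma polytime_fold g (B : {poly nat}) c a l :
  polytime g ->
  (forall c a e, tree_size (g (Node c (Node a e)))
     <= tree_size a + B.[(tree_size c + tree_size e)%N]%R) ->
  polytime c -> polytime a -> polytime l ->
  polytime (fun x => foldt g (c x) (a x) (l x)).
Proof.
move=> [G [q [cG _]]] gB pc pa pl.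
pose h x := foldt g (hd x) (hd (tl x)) (tl (tl x)).
suff ph : polytime h.
  by apply: (polytime_comp ph (polytime_node pc (polytime_node pa pl))).
(* The successor is for [x = Leaf], where both projections are again leaves, of total size 2. *)
have sz x : [/\ tree_size (hd x) + tree_size (tl (tl x)) <= (tree_size x).+1,
    tree_size (hd (tl x)) <= tree_size x & tree_size (tl (tl x)) <= tree_size x].
  by case: x => [|c' [|a' l']] /=; split; lia.
(* This is the bound [M] of [exec_fold] for [N = n.+1], with accumulator and list of size at most
   [n]; it also bounds the size of the result. *)
have [m mE] : exists m : {poly nat},
    forall n, m.[n]%R = 2 + n.+1 + n + n * B.[n.+1]%R.
  exists (3%:P + 'X + 'X + 'X * (B \Po ('X + 1)))%R => n.
  rewrite !(hornerD, hornerM, horner_comp, hornerX, hornerC).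
  by rewrite -[(n + 1)%R]/(n + 1) addn1 addnS.
apply: (@polytime_intro (fun d =>
    [:: Assign d.+1 (ETl d); Assign d (EHd d); Assign d.+2 (ETl d.+1);
        Assign d.+1 (EHd d.+1); While d.+2 (fold_body G d)] ++
    [:: Assign d (EVar d.+1); Assign d.+1 ELeaf]) _
  (fun n => (n * (q.[m.[n]]%R + 7)).+1.+4 + 2)
  ('X * ((q \Po m) + 7%:P) + 7%:P)%R m).
- move=> d s sd; apply: (@exec_cat _ _ _ (fold_store s d (hd (s d)) (h (s d)) Leaf)).
    do 4 apply: exec_assign.
    have [sz1 sz2 sz3] := sz (s d).
    set s1 := update _ d.+1 _.
    have -> : s1 = fold_store s d (hd (s d)) (hd (tl (s d))) (tl (tl (s d))).
      by rewrite /s1 /fold_store; store_eq; rewrite ?sd //; lia.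
    apply: exec_le (exec_fold cG (gB _) sd sz1 (_ : _ <= m.[tree_size (s d)]%R)).
      by rewrite ltnS leq_mul2r sz3 orbT.
    by rewrite mE; nia.
  do 2 apply: exec_assign; set s1 := update _ d.+1 _.
  have -> : update s d (h (s d)) = s1.
    by rewrite /s1 /fold_store; store_eq; rewrite ?sd //; lia.
  exact: exec_nil.
- move=> n; rewrite !(hornerD, hornerM, horner_comp, hornerX, hornerC).
  by change (n * (q.[m.[n]] + 7) + 7)%R with (n * (q.[m.[n]]%R + 7) + 7); lia.
- move=> x; have [sz1 sz2 sz3] := sz x.
  apply: leq_trans (tree_size_foldt _ (gB _) sz1) _; rewrite mE.
  by nia.
Qed.

(** * Operations on encoded lists, sets and numbers *)

Lemma polytime_const x : polytime (fun=> x).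
Proof. by elim: x => [|l IHl r IHr]; [exact: polytime_leaf | exact: polytime_node]. Qed.

Lemma polytime_fold_linear g b c a l :
  polytime g ->
  (forall c a e, tree_size (g (Node c (Node a e))) <= tree_size a + tree_size e + b) ->
  polytime c -> polytime a -> polytime l ->
  polytime (fun x => foldt g (c x) (a x) (l x)).
Proof.
move=> pg gb; apply: (@polytime_fold _ ('X + b%:P)%R) => // c' a' e.
rewrite hornerD hornerX hornerC.
apply: leq_trans (gb c' a' e) _.
by rewrite -[(_ + b)%R]/(tree_size c' + tree_size e + b); lia.
Qed.

(** Supplies the polynomial [B] that [polytime_fold] asks for when the step calls [h]; the shift by
    1 is the node packing the two arguments. *)
Lemma polytime_bound2 h : polytime (fun x => h (hd x) (tl x)) ->
  exists B : {poly nat},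
    forall a b, tree_size (h a b) <= B.[(tree_size a + tree_size b)%N]%R.
Proof.
move=> [P [q [_ hq]]]; exists (q \Po ('X + 1))%R => a b.
rewrite horner_comp hornerD hornerX hornerC.
by rewrite -[(_ + 1)%R]/(tree_size a + tree_size b + 1) addn1; exact: hq (Node a b).
Qed.

Lemma polytime2 h f g : polytime (fun x => h (hd x) (tl x)) ->
  polytime f -> polytime g -> polytime (fun x => h (f x) (g x)).
Proof. by move=> ph pf pg; apply: (polytime_comp ph (polytime_node pf pg)). Qed.

Ltac polytime_tac := cbv zeta; repeat first
  [ assumption | exact: polytime_id | exact: polytime_const
  | apply: polytime_if | apply: polytime_node | apply: polytime_hd
  | apply: polytime_tl ].

(** * Lists of bits: reversal, disjunction, equality, increment *)

Definition enc_bits (s : seq bool) : tree := enc_seq [seq enc_bool b | b <- s].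

Definition rev_step (y : tree) : tree := Node (tl (tl y)) (hd (tl y)).

Definition tree_rev (l : tree) : tree := foldt rev_step Leaf Leaf l.

Lemma tree_rev_enc_seq s : tree_rev (enc_seq s) = enc_seq (rev s).
Proof.
rewrite /tree_rev foldt_enc_seq /=; set f := fun _ _ => _.
suff H t : foldl f (enc_seq t) s = enc_seq (catrev s t) by exact: (H [::]).
by elim: s t => //= e s IHs t; exact: (IHs (e :: t)).
Qed.

Lemma tree_size_rev l : tree_size (tree_rev l) <= tree_size l.
Proof.
suff H a : (tree_size (foldt rev_step Leaf a l)).+1 <= tree_size a + tree_size l.
  exact: (H Leaf).
elim: l a => [|e _ l IHl] a; first by rewrite addn1.
by apply: leq_trans (IHl _) _ => /=; lia.
Qed.

Lemma polytime_rev f : polytime f -> polytime (fun x => tree_rev (f x)).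
Proof.
move=> pf; apply: (@polytime_fold_linear _ 1) => //; try exact: polytime_const.
- by rewrite /rev_step; polytime_tac.
- by move=> c a e /=; lia.
Qed.

(** The fold runs along the first list only. The accumulator pairs the unread part of the second
    list with the output in reverse order. *)
Definition or_step (y : tree) : tree :=
  let a := hd (tl y) in let e := tl (tl y) in
  Node (tl (hd a)) (Node (if is_node e then e else hd (hd a)) (tl a)).

Definition tree_or (a b : tree) : tree :=
  tree_rev (tl (foldt or_step Leaf (Node b Leaf) a)).

Lemma tree_or_enc_bits s t : seq.size s = seq.size t ->
  tree_or (enc_bits s) (enc_bits t) = enc_bits [seq p.1 || p.2 | p <- zip s t].
Proof.
rewrite /tree_or => st.
suff -> : tl (foldt or_step Leaf (Node (enc_bits t) Leaf) (enc_bits s))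
    = enc_seq (rev [seq enc_bool (p.1 || p.2) | p <- zip s t]).
  by rewrite tree_rev_enc_seq revK /enc_bits -map_comp.
rewrite foldt_enc_seq /=; set f := fun _ _ => _.
suff H u : tl (foldl f (Node (enc_bits t) (enc_seq u)) [seq enc_bool b | b <- s])
    = enc_seq (catrev [seq enc_bool (p.1 || p.2) | p <- zip s t] u) by exact: (H [::]).
elim: s t u st => [|b s IHs] [|c t] //= u [st].
rewrite -(IHs t) //; congr (tl (foldl _ _ _)).
by rewrite /f /or_step /=; case: b; case: c.
Qed.

Lemma polytime_or f g : polytime f -> polytime g ->
  polytime (fun x => tree_or (f x) (g x)).
Proof.
move=> pf pg; apply/polytime_rev/polytime_tl.
apply: (@polytime_fold_linear _ 5); polytime_tac => //.
by move=> c [|[|b b'] o] e /=; case: e => /=; lia.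
Qed.

(** The accumulator pairs the unread part of the second list with a flag; the flag also falls when
    the second list ends too early. A second list that is too long is detected after the loop, by a
    nonempty remainder. *)
Definition eq_step (y : tree) : tree :=
  let b := hd (hd (tl y)) in let flag := tl (hd (tl y)) in let e := tl (tl y) in
  Node (tl b) (if is_node flag then
    if is_node b then
      if is_node e then hd b
      else if is_node (hd b) then Leaf else enc_bool true
    else Leaf else Leaf).

Definition tree_eq (a b : tree) : tree :=
  let r := foldt eq_step Leaf (Node b (enc_bool true)) a in
  if is_node (hd r) then Leaf else tl r.

Lemma tree_eq_enc_bits s t :
  is_node (tree_eq (enc_bits s) (enc_bits t)) = (s == t).
Proof.
rewrite /tree_eq {1}/enc_bits foldt_enc_seq; set f := fun _ _ => _.
pose fin r := if is_node (hd r) then Leaf else tl r.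
suff H flag : is_node (fin (foldl f (Node (enc_bits t) flag) [seq enc_bool b | b <- s]))
    = is_node flag && (s == t) by exact: H.
elim: s t flag => [|b s IHs] [|c t] flag; rewrite ?andbT ?andbF //.
  by rewrite [foldl _ _ _]/=; have /= -> := IHs [::]; case: flag.
by rewrite [foldl _ _ _]/= IHs; case: flag; case: b; case: c; rewrite /= ?andbF.
Qed.

Lemma polytime_eq f g : polytime f -> polytime g ->
  polytime (fun x => tree_eq (f x) (g x)).
Proof.
have pfold : polytime (fun x => foldt eq_step Leaf (Node (tl x) (enc_bool true)) (hd x)).
  apply: (@polytime_fold_linear _ 5); polytime_tac => //.
  by move=> c [|[|[|b1 b2] b'] [|o1 o2]] [|e1 e2] /=; lia.
apply: (@polytime2 tree_eq); rewrite /tree_eq.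
by apply: polytime_if (polytime_hd pfold) (polytime_const _) (polytime_tl pfold).
Qed.

(** The accumulator pairs the carry with the reversed output; bits come least significant first. *)
Definition inc_step (y : tree) : tree :=
  let carry := hd (hd (tl y)) in let out := tl (hd (tl y)) in let e := tl (tl y) in
  if is_node carry then
    if is_node e then Node carry (Node Leaf out)
    else Node Leaf (Node (enc_bool true) out)
  else Node Leaf (Node e out).

Definition tree_inc (l : tree) : tree :=
  let r := foldt inc_step Leaf (Node (enc_bool true) Leaf) l in
  tree_rev (if is_node (hd r) then Node (enc_bool true) (tl r) else tl r).

Fixpoint inc_bits (s : seq bool) : seq bool :=
  match s with
  | [::] => [:: true]
  | false :: s' => true :: s'
  | true :: s' => false :: inc_bits s'
  end.

Lemma tree_inc_enc_bits s : tree_inc (enc_bits s) = enc_bits (inc_bits s).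
Proof.
rewrite /tree_inc /enc_bits foldt_enc_seq; set f := fun _ _ => _.
pose fin r := if is_node (hd r) then Node (enc_bool true) (tl r) else tl r.
(* Once the carry is absorbed, the remaining bits are copied. *)
have nocarry t u : fin (foldl f (Node Leaf (enc_seq u)) [seq enc_bool b | b <- t])
    = enc_seq (catrev [seq enc_bool b | b <- t] u).
  by elim: t u => //= b t IHt u; exact: (IHt (enc_bool b :: u)).
rewrite -[if _ then _ else _]/(fin _).
suff -> : fin (foldl f (Node (enc_bool true) Leaf) [seq enc_bool b | b <- s])
    = enc_seq (rev [seq enc_bool b | b <- inc_bits s]).
  by rewrite tree_rev_enc_seq revK.
suff H u : fin (foldl f (Node (enc_bool true) (enc_seq u)) [seq enc_bool b | b <- s])
    = enc_seq (catrev [seq enc_bool b | b <- inc_bits s] u) by exact: (H [::]).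
elim: s u => [|[] s IHs] u //=; first exact: (IHs (Leaf :: u)).
exact: (nocarry s (enc_bool true :: u)).
Qed.

(** The bound is additive so that the increment can itself be the step of a fold, as in
    [min_step]. *)
Lemma tree_size_inc l : tree_size (tree_inc l) <= tree_size l + 6.
Proof.
apply: leq_trans (tree_size_rev _) _.
have H c o : (tree_size (foldt inc_step Leaf (Node c o) l)).+1
    <= tree_size (Node c o) + tree_size l.
  elim: l c o => [|e _ l IHl] c o; first by rewrite addn1.
  case: c e => [|c1 c2] [|e1 e2]; apply: leq_trans (IHl _ _) _ => /=; try lia.
  by move: (tree_size_gt0 c1) (tree_size_gt0 c2); lia.
move: (H (enc_bool true) Leaf) => /=.
by case: (foldt _ _ _ _) => [|[|c c'] o] /=; lia.
Qed.

Lemma polytime_inc f : polytime f -> polytime (fun x => tree_inc (f x)).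
Proof.
have pfold : polytime (foldt inc_step Leaf (Node (enc_bool true) Leaf)).
  apply: (@polytime_fold_linear _ 6 _ _ (fun x => x)); polytime_tac => //.
  by move=> c [|[|c1 c2] o] [|e1 e2] /=; lia.
apply: (@polytime_comp tree_inc); apply: polytime_rev.
apply: polytime_if; first exact: polytime_hd.
  by apply: polytime_node; [exact: polytime_const | exact: polytime_tl].
exact: polytime_tl.
Qed.

(** * Lists without repetition and their pairwise unions *)

Definition mem_step (y : tree) : tree :=
  if is_node (hd (tl y)) then hd (tl y) else tree_eq (hd y) (tl (tl y)).

Definition tree_mem (x l : tree) : tree := foldt mem_step x Leaf l.

Lemma is_node_tree_mem x l :
  is_node (tree_mem x (enc_seq l)) = has (fun e => is_node (tree_eq x e)) l.
Proof.
rewrite /tree_mem foldt_enc_seq; set f := fun _ _ => _.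
suff H a : is_node (foldl f a l) = is_node a || has (fun e => is_node (tree_eq x e)) l.
  exact: H.
elim: l a => [|e l IHl] a /=; first by rewrite orbF.
by rewrite IHl /f /mem_step /=; case: a.
Qed.

Lemma polytime_mem f g : polytime f -> polytime g ->
  polytime (fun x => tree_mem (f x) (g x)).
Proof.
move=> pf pg.
have [B hB] : exists B : {poly nat},
    forall a b, tree_size (tree_eq a b) <= B.[(tree_size a + tree_size b)%N]%R.
  by apply: polytime_bound2; apply: polytime_eq; polytime_tac.
apply: (@polytime_fold _ B) => //; last exact: polytime_const.
- by apply: polytime_if; [| |apply: polytime_eq]; polytime_tac.
- move=> c a e; rewrite /mem_step /=; case: ifP => _; first exact: leq_addr.
  exact: leq_trans (hB c e) (leq_addl _ _).
Qed.

(** The membership test keeps families free of repetitions, as [sc_uniq] demands. *)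
Definition tree_adjoin (x l : tree) : tree :=
  if is_node (tree_mem x l) then l else Node x l.

Lemma polytime_adjoin f g : polytime f -> polytime g ->
  polytime (fun x => tree_adjoin (f x) (g x)).
Proof.
move=> pf pg; rewrite /tree_adjoin; apply: polytime_if => //.
  exact: polytime_mem.
exact: polytime_node.
Qed.

Definition or_adjoin_step (y : tree) : tree :=
  tree_adjoin (tree_or (hd y) (tl (tl y))) (hd (tl y)).

(** Outer loop of two nested ones: its context is the whole list, which the inner fold traverses
    with the current element as its own context. Both loops share the accumulator. *)
Definition pairwise_or_step (y : tree) : tree :=
  foldt or_adjoin_step (tl (tl y)) (hd (tl y)) (hd y).

Definition tree_pairwise_or (l : tree) : tree := foldt pairwise_or_step l Leaf l.

Lemma polytime_pairwise_or f : polytime f -> polytime (fun x => tree_pairwise_or (f x)).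
Proof.
move=> pf.
have [B hB] : exists B : {poly nat},
    forall a b, tree_size (tree_or a b) <= B.[(tree_size a + tree_size b)%N]%R.
  by apply: polytime_bound2; apply: polytime_or; polytime_tac.
have p_step : polytime or_adjoin_step.
  by rewrite /or_adjoin_step; apply: polytime_adjoin; [apply: polytime_or|]; polytime_tac.
have s_step c a e : tree_size (or_adjoin_step (Node c (Node a e)))
    <= tree_size a + (B + 1).[(tree_size c + tree_size e)%N]%R.
  rewrite hornerD hornerC -[(_ + 1)%R]/(B.[(tree_size c + tree_size e)%N]%R + 1).
  rewrite /or_adjoin_step /tree_adjoin /=.
  by have := hB c e; case: ifP => _ /=; lia.
(* The inner loop makes at most [tree_size c] steps, each adding at most the value of [B + 1]. *)
apply: (@polytime_fold _ ('X * (B + 1))%R) => //; last exact: polytime_const.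
  by apply: (polytime_fold p_step s_step); polytime_tac.
move=> c a e; rewrite hornerM hornerX /pairwise_or_step /=.
apply: leq_trans (tree_size_foldt _ (s_step _) (leqnn _)) _.
rewrite leq_add2l addnC; apply: leq_mul => //; exact: leq_addr.
Qed.

(** * Binary numerals and incidence vectors *)

Fixpoint pos_bits (p : BinNums.positive) : seq bool :=
  match p with
  | BinNums.xH => [:: true]
  | BinNums.xO p' => false :: pos_bits p'
  | BinNums.xI p' => true :: pos_bits p'
  end.

Definition nat_bits (n : nat) : seq bool :=
  if bin_of_nat n is BinNums.Npos p then pos_bits p else [::].

Lemma enc_nat_bits n : enc_nat n = enc_bits (nat_bits n).
Proof.
rewrite /enc_nat /nat_bits; case: (bin_of_nat n) => // p.
by elim: p => //= p ->.
Qed.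

Lemma nat_bits_pos (p : BinNums.positive) : nat_bits (nat_of_pos p) = pos_bits p.
Proof. by rewrite /nat_bits -[nat_of_pos p]/(nat_of_bin (BinNums.Npos p)) nat_of_binK. Qed.

Lemma nat_pos_case (n : nat) : n = 0 \/ exists p, n = nat_of_pos p.
Proof.
by rewrite -(bin_of_natK n); case: (bin_of_nat n) => [|p]; [left | right; exists p].
Qed.

(** A positive number never yields the empty list, so the constructors of [positive] can be read off
    the bits. This makes [tree_eq] an equality test on numbers. *)
Lemma nat_bits_inj : injective nat_bits.
Proof.
have bits0 (p : BinNums.positive) : pos_bits p <> [::] by case: p.
have pos_bits_inj : injective pos_bits.
  move=> p; elim: p => [p IHp|p IHp|] q; case: q => [q|q|] //= [] pq;
    rewrite ?(IHp _ pq) //;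
    by [case: (bits0 _ pq) | case: (bits0 _ (esym pq))].
move=> m n; case: (nat_pos_case m) => [->|[p ->]]; case: (nat_pos_case n) => [->|[q ->]] //;
  rewrite ?nat_bits_pos; by [move/esym/bits0 | move/bits0 | move/pos_bits_inj->].
Qed.

Lemma nat_bits_succ n : nat_bits n.+1 = inc_bits (nat_bits n).
Proof.
case: (nat_pos_case n) => [->//|[p ->]].
rewrite -nat_of_succ_pos !nat_bits_pos.
by elim: p => //= p ->.
Qed.

Lemma nat_bits_half n : nat_bits n./2 = behead (nat_bits n).
Proof.
case: (nat_pos_case n) => [->//|[p ->]]; rewrite nat_bits_pos.
by case: p => [p|p|] //=; rewrite NatTrec.doubleE ?uphalf_double ?doubleK nat_bits_pos.
Qed.

Lemma nat_bits_odd n : odd n = head false (nat_bits n).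
Proof.
case: (nat_pos_case n) => [->//|[p ->]]; rewrite nat_bits_pos.
by case: p => [p|p|] //=; rewrite NatTrec.doubleE odd_double.
Qed.

Lemma tree_eq_enc_nat m n : is_node (tree_eq (enc_nat m) (enc_nat n)) = (m == n).
Proof. by rewrite !enc_nat_bits tree_eq_enc_bits (inj_eq nat_bits_inj). Qed.

Lemma tree_inc_enc_nat n : tree_inc (enc_nat n) = enc_nat n.+1.
Proof. by rewrite !enc_nat_bits tree_inc_enc_bits nat_bits_succ. Qed.

Lemma tl_enc_nat n : tl (enc_nat n) = enc_nat n./2.
Proof. by rewrite !enc_nat_bits nat_bits_half; case: (nat_bits n). Qed.

Lemma is_node_hd_enc_nat n : is_node (hd (enc_nat n)) = odd n.
Proof. by rewrite enc_nat_bits nat_bits_odd; case: (nat_bits n) => // -[]. Qed.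

Lemma enc_set_bits n (S : {set 'I_n}) : enc_set S = enc_bits [seq i \in S | i <- enum 'I_n].
Proof. by rewrite /enc_set /enc_bits -map_comp. Qed.

Lemma tree_eq_enc_set n (S T : {set 'I_n}) :
  is_node (tree_eq (enc_set S) (enc_set T)) = (S == T).
Proof.
rewrite !enc_set_bits tree_eq_enc_bits; apply/eqP/eqP => [/eq_in_map ST|->//].
by apply/setP => i; apply: ST; rewrite mem_enum.
Qed.

Lemma tree_or_enc_set n (S T : {set 'I_n}) :
  tree_or (enc_set S) (enc_set T) = enc_set (S :|: T).
Proof.
rewrite !enc_set_bits tree_or_enc_bits ?size_map // zip_map -map_comp.
by congr enc_bits; apply: eq_map => i /=; rewrite inE.
Qed.

Lemma enc_set_empty n : enc_set (finset.set0 : {set 'I_n}) = enc_seq (nseq n Leaf).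
Proof.
rewrite /enc_set; congr enc_seq; rewrite -[in RHS](size_enum_ord n).
by elim: (enum _) => //= i s ->; rewrite inE.
Qed.

(** * The reduction *)

(** Covers as lists, possibly with repetitions: a repetition only makes the list longer than the set
    it lists, so the budget is still respected. *)
Lemma has_coverP k (I : set_cover_instance k) :
  reflect (exists s, [/\ {subset s <= sc_family I}, (seq.size s <= sc_t I)
    & forall i, has (fun S : {set _} => i \in S) s]) (has_cover I).
Proof.
apply: (iffP existsP) => [[C /and3P[/fintype.subsetP CF Ct /eqP Ccov]]|[s [sF st scov]]].
  exists (enum C); split=> [S|| i]; first by rewrite mem_enum => /CF.
    by rewrite -cardE.
  have : i \in finset.cover C by rewrite Ccov inE.
  by case/bigcupP => S SC iS; apply/hasP; exists S; rewrite ?mem_enum.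
exists [set S in s]; apply/and3P; split.
- by apply/fintype.subsetP => S; rewrite inE => /sF.
- by apply: leq_trans st; rewrite cardsE card_size.
- apply/eqP/setP => i; rewrite inE; apply/bigcupP.
  by have /hasP[S Ss iS] := scov i; exists S => //; rewrite inE.
Qed.

Definition min_step (y : tree) : tree :=
  if is_node (tree_eq (hd (tl y)) (hd y)) then hd (tl y) else tree_inc (hd (tl y)).

(** As [t] is in binary while the universe is a list, the minimum is obtained by counting up from 0
    along that list and stopping at [t]. *)
Definition tree_min (x : tree) : tree :=
  Node (hd x) (Node (hd (tl x)) (foldt min_step (tl (tl x)) Leaf (hd x))).

Lemma polytime_tree_min : polytime tree_min.
Proof.
have p_step : polytime min_step.
  by apply: polytime_if; [apply: polytime_eq| |apply: polytime_inc]; polytime_tac.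
apply: polytime_node; first by polytime_tac.
apply: polytime_node; first by polytime_tac.
apply: (polytime_fold_linear (b := 6) p_step); try by polytime_tac.
move=> c a e; rewrite /min_step /=; case: ifP => _; first by lia.
by have := tree_size_inc a; lia.
Qed.

(** Capping the budget at the size of the universe is harmless: one set per element suffices. *)
Lemma tree_min_enc k (I : set_cover_instance k) :
  exists I' : set_cover_instance k, [/\ enc_set_cover I' = tree_min (enc_set_cover I),
    sc_n I' = sc_n I, sc_t I' = minn (sc_t I) (sc_n I) & has_cover I' = has_cover I].
Proof.
exists (SetCoverInstance (minn (sc_t I) (sc_n I)) (sc_uniq I) (sc_small I)); split=> //.
  rewrite /tree_min /enc_set_cover /= foldt_enc_seq; congr (Node _ (Node _ _)).
  set f := fun _ _ => _.
  suff H m b : b <= sc_t I ->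
      foldl f (enc_nat b) (nseq m Leaf) = enc_nat (minn (sc_t I) (b + m)).
    exact/esym/(H _ 0).
  elim: m b => [|m IHm] b bt /=; first by rewrite addn0 (minn_idPr bt).
  rewrite /f /min_step /= tree_eq_enc_nat tree_inc_enc_nat -/f.
  case: eqP => [->|/eqP bt']; last by rewrite IHm ?addSnnS // ltn_neqAle bt'.
  by rewrite IHm // !(minn_idPl _) // leq_addr.
apply/has_coverP/has_coverP => -[s [/= sF st scov]].
  by exists s; split=> //; apply: leq_trans st (geq_minl _ _).
case: (leqP (sc_t I) (sc_n I)) => [tn|nt].
  by exists s.
(* For each element, the first member of [s] containing it; the default is never reached, because
   [s] covers. *)
exists [seq nth finset.set0 s (find (fun S : {set _} => i \in S) s) | i <- enum 'I_(sc_n I)].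
split=> [S /mapP[i _ ->]|| i].
- by apply/sF/mem_nth; rewrite -has_find.
- by rewrite size_map size_enum_ord /=.
- apply/hasP; exists (nth finset.set0 s (find (fun S : {set _} => i \in S) s)).
    by apply/mapP; exists i; rewrite ?mem_enum.
  exact: (nth_find finset.set0 (scov i)).
Qed.

Definition pad_step (y : tree) : tree :=
  Node (Node Leaf (tl (tl y))) (hd (tl y)).

(** The test reads the lowest bit of [t]. The new element comes first: old sets get a leading 0, and
    its singleton is a 1 followed by [U], which doubles as the vector of the empty set. *)
Definition tree_pad (x : tree) : tree :=
  let U := hd x in let F := hd (tl x) in let t := tl (tl x) in
  if is_node (hd t) then
    Node (Node Leaf U)
      (Node (foldt pad_step Leaf (Node (Node (enc_bool true) U) Leaf) F) (tree_inc t))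
  else x.

Lemma polytime_tree_pad : polytime tree_pad.
Proof.
apply: polytime_if; [by polytime_tac| |by polytime_tac].
apply: polytime_node; first by polytime_tac.
apply: polytime_node; last by apply: polytime_inc; polytime_tac.
apply: (@polytime_fold_linear _ 3); try by polytime_tac.
by move=> c a e /=; lia.
Qed.

Lemma enc_set_lift n (S : {set 'I_n}) :
  enc_set (lift ord0 @: S) = Node Leaf (enc_set S).
Proof.
rewrite /enc_set enum_ordSl /= -map_comp.
have -> : (ord0 \in lift ord0 @: S) = false.
  by apply/imsetP => -[i _ /(congr1 val)].
congr (Node _ (enc_seq _)); apply: eq_map => i /=.
by rewrite mem_imset //; exact: lift_inj.
Qed.

Lemma enc_set_ord0 n :
  enc_set [set ord0 : 'I_n.+1] = Node (enc_bool true) (enc_seq (nseq n Leaf)).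
Proof.
rewrite /enc_set enum_ordSl /= inE eqxx -map_comp; congr (Node _ (enc_seq _)).
rewrite -[in RHS](size_enum_ord n); elim: (enum _) => //= i s ->.
by rewrite inE.
Qed.

(** Only the added singleton contains the new element, so every cover must spend one unit of the
    budget on it. The hypothesis [0 < k] admits this singleton in the family. *)
Lemma tree_pad_enc k (I : set_cover_instance k) : 0 < k ->
  exists I' : set_cover_instance k, [/\ enc_set_cover I' = tree_pad (enc_set_cover I),
    sc_n I' <= (sc_n I).+1, sc_t I' = sc_t I + odd (sc_t I)
    & has_cover I' = has_cover I].
Proof.
move=> k0; rewrite /tree_pad /= is_node_hd_enc_nat.
case: ifP => todd; last by exists I; rewrite addn0.
case: I todd => n F t Fu Fk /= todd; pose up (S : {set 'I_n}) := lift ord0 @: S.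
have up_inj : injective up by apply: imset_inj; exact: lift_inj.
have ord0_up S : ord0 \in up S = false by apply/imsetP => -[i _ /(congr1 val)].
(* The fold in [tree_pad] pushes the old sets one by one in front of the singleton, which reverses
   their order. *)
pose F' := catrev (map up F) [:: [set ord0]].
have memF' S : (S \in F') = (S == [set ord0]) || (S \in map up F).
  by rewrite /F' catrevE mem_cat mem_rev inE orbC.
have F'u : uniq F'.
  rewrite /F' catrevE cat_uniq rev_uniq map_inj_uniq // Fu /= orbF andbT mem_rev.
  by apply/mapP => -[S _ /setP/(_ ord0)]; rewrite ord0_up inE eqxx.
have F'k : all (fun S : {set 'I_n.+1} => #|S| <= k) F'.
  apply/allP => S; rewrite memF' => /orP[/eqP->|/mapP[T TF ->]]; first by rewrite cards1.
  by rewrite card_imset; [exact: (allP Fk) | exact: lift_inj].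
exists (SetCoverInstance t.+1 F'u F'k); split=> //=; last 1 first.
- apply/has_coverP/has_coverP => /= -[s [/= sF st scov]].
    pose down (S : {set 'I_n.+1}) : {set 'I_n} := [set i | lift ord0 i \in S].
    exists (map down (seq.filter (fun S => S != [set ord0]) s)); split=> [T|| i].
    + case/mapP => S; rewrite mem_filter => /andP[/= S0 /sF].
      rewrite memF' (negbTE S0) /= => /mapP[T' T'F ->] ->.
      suff -> : down (up T') = T' by [].
      by apply/setP => i; rewrite inE mem_imset //; exact: lift_inj.
    + rewrite size_map size_filter -ltnS; apply: leq_trans st.
      rewrite -(count_predC (pred1 [set ord0])) -addn1 addnC leq_add2r -has_count.
      (* The set covering [ord0] has to be the singleton, so filtering it out shortens the list. *)
      have /hasP[S Ss S0] := scov ord0; apply/hasP; exists S => //=.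
      by have := sF S Ss; rewrite memF' => /orP[//|/mapP[T _ ST]]; rewrite ST ord0_up in S0.
    + have /hasP[S Ss iS] := scov (lift ord0 i).
      apply/hasP; exists (down S); last by rewrite inE.
      rewrite map_f // mem_filter Ss andbT /=.
      by apply: contraTneq iS => ->; rewrite inE.
  exists ([set ord0] :: map up s); split=> [S|| i].
  + rewrite inE memF' => /orP[->//|/mapP[T /sF TF ->]].
    by rewrite map_f ?orbT.
  + by rewrite /= size_map.
  + rewrite /= inE; case: (unliftP ord0 i) => [j ->|->]; last by rewrite eqxx.
    apply/orP; right; have /hasP[S Ss jS] := scov j.
    by apply/hasP; exists (up S); [exact: map_f | exact: imset_f].
- rewrite /enc_set_cover /= tree_inc_enc_nat foldt_enc_seq; congr (Node _ (Node _ _)).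
  rewrite -enc_set_ord0 -[Node _ Leaf]/(enc_seq (map (@enc_set _) [:: [set ord0]])) /F'.
  elim: (F) [:: _] => //= S L IHL u.
  by rewrite IHL /= enc_set_lift.
- by rewrite addn1.
Qed.

(* The list of n leaves that encodes the universe also encodes the empty set. *)
Definition tree_halve (x : tree) : tree :=
  Node (hd x) (Node (tree_pairwise_or (Node (hd x) (hd (tl x)))) (tl (tl (tl x)))).

Lemma polytime_tree_halve : polytime tree_halve.
Proof.
apply: polytime_node; first by polytime_tac.
apply: polytime_node; last by polytime_tac.
by apply: polytime_pairwise_or; polytime_tac.
Qed.

Definition adjoin (T : eqType) (s : seq T) (x : T) : seq T := if x \in s then s else x :: s.

Lemma foldl_adjoin (T : eqType) (s t : seq T) : uniq s ->
  uniq (foldl (@adjoin T) s t) /\ foldl (@adjoin T) s t =i s ++ t.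
Proof.
elim: t s => [|x t IHt] s su /=; first by split=> // y; rewrite cats0.
have /IHt[u m] : uniq (adjoin s x) by rewrite /adjoin; case: ifP => //= ->.
split=> // y; rewrite m !mem_cat inE /adjoin orbCA; case: ifP => [xs|_].
  by case: eqP => // ->; rewrite xs.
by rewrite inE orbA.
Qed.

Lemma tree_adjoin_enc n (S : {set 'I_n}) L :
  tree_adjoin (enc_set S) (enc_seq (map (@enc_set n) L))
    = enc_seq (map (@enc_set n) (adjoin L S)).
Proof.
rewrite /tree_adjoin is_node_tree_mem has_map /adjoin.
have -> : has (preim (@enc_set n) (fun e => is_node (tree_eq (enc_set S) e))) L = (S \in L).
  by rewrite -has_pred1; apply: eq_has => T /=; rewrite tree_eq_enc_set eq_sym.
by case: ifP.
Qed.

Definition pairwise_unions n (L : seq {set 'I_n}) : seq {set 'I_n} :=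
  foldl (@adjoin _) [::] [seq A :|: B | A <- L, B <- L].

Lemma tree_pairwise_or_enc n (L : seq {set 'I_n}) :
  tree_pairwise_or (enc_seq (map (@enc_set n) L)) =
    enc_seq (map (@enc_set n) (pairwise_unions L)).
Proof.
rewrite /tree_pairwise_or foldt_enc_seq /pairwise_unions.
rewrite -[Leaf in LHS]/(enc_seq (map (@enc_set n) [::])).
have inner A M out : foldt or_adjoin_step (enc_set A) (enc_seq (map (@enc_set n) out))
      (enc_seq (map (@enc_set n) M))
    = enc_seq (map (@enc_set n) (foldl (@adjoin _) out [seq A :|: B | B <- M])).
  rewrite foldt_enc_seq; elim: M out => //= B M IHM out.
  by rewrite /or_adjoin_step /= tree_or_enc_set tree_adjoin_enc -IHM.
(* Only the list of the outer loop is generalized; the inner loop keeps running over the whole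
   [L]. *)
elim: {2 4}L [::] => //= A M IHM out.
by rewrite foldl_cat -IHM /pairwise_or_step /= inner.
Qed.

Lemma pairwise_unions_uniq n (L : seq {set 'I_n}) : uniq (pairwise_unions L).
Proof. by have [] := @foldl_adjoin _ [::] [seq A :|: B | A <- L, B <- L] isT. Qed.

Lemma mem_pairwise_unions n (L : seq {set 'I_n}) :
  pairwise_unions L =i [seq A :|: B | A <- L, B <- L].
Proof. by have [] := @foldl_adjoin _ [::] [seq A :|: B | A <- L, B <- L] isT. Qed.

Lemma pairwise_unions_small n k (F : seq {set 'I_n}) :
  all (fun S : {set _} => #|S| <= k) F ->
  all (fun S : {set _} => #|S| <= k.*2) (pairwise_unions (finset.set0 :: F)).
Proof.
move=> Fk; apply/allP => S; rewrite mem_pairwise_unions => /allpairsP[[A B] /= [AF BF ->]].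
have small T : T \in finset.set0 :: F -> #|T| <= k.
  by rewrite inE => /orP[/eqP->|/(allP Fk)//]; rewrite cards0.
rewrite cardsU; apply: leq_trans (leq_subr _ _) _.
by rewrite -addnn leq_add ?small.
Qed.

(** A union unfolds into at most two members of [F]; conversely, a cover is cut into consecutive
    pairs, a last unpaired set being joined with the empty set. Since [t] is even, half the length
    of the cover still fits into [t./2] after rounding up. *)
Lemma tree_halve_enc k (I : set_cover_instance k) : ~~ odd (sc_t I) ->
  exists I' : set_cover_instance k.*2, [/\ enc_set_cover I' = tree_halve (enc_set_cover I),
    sc_n I' = sc_n I, sc_t I' = (sc_t I)./2 & has_cover I' = has_cover I].
Proof.
case: I => n F t Fu Fk /= teven.
exists (SetCoverInstance t./2 (pairwise_unions_uniq (finset.set0 :: F))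
  (pairwise_unions_small Fk)).
split=> //=.
  rewrite /tree_halve /enc_set_cover /= tl_enc_nat; congr (Node _ (Node _ _)).
  by rewrite -tree_pairwise_or_enc /= enc_set_empty.
apply/has_coverP/has_coverP => /= -[s [/= sF st scov]].
  have [s' [s'F s's covE]] : exists s', [/\ {subset s' <= F}, seq.size s' <= (seq.size s).*2
      & forall i, has (fun S : {set _} => i \in S) s -> has (fun S : {set _} => i \in S) s'].
    elim: s sF {st scov} => [|S s IHs] sF; first by exists [::].
    have [|s' [s'F s's covE]] := IHs; first by move=> T Ts; rewrite sF // inE Ts orbT.
    have := sF S (mem_head _ _); rewrite mem_pairwise_unions => /allpairsP[[A B] /= [AF BF ->]].
    (* The filter discards the empty set when it was only adjoined to [F]; this loses no element. *)
    exists ([seq T <- [:: A; B] | T \in F] ++ s'); split=> [T|| i].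
    - by rewrite mem_cat mem_filter => /orP[/andP[]//|/s'F].
    - by rewrite size_cat doubleS -add2n leq_add //=; case: ifP; case: ifP.
    - rewrite has_cat => /orP[|/covE->]; last by rewrite orbT.
      have mem T : T \in finset.set0 :: F -> i \in T -> T \in F.
        by rewrite inE => /orP[/eqP->|//]; rewrite inE.
      rewrite inE => /orP[iA|iB]; apply/orP; left; apply/hasP.
        by exists A; rewrite // mem_filter (mem A) // inE eqxx.
      by exists B; rewrite // mem_filter (mem B) // !inE eqxx orbT.
  exists s'; split=> //= [|i]; last exact: covE.
  by apply: leq_trans s's _; rewrite -[leqRHS](even_halfK teven) leq_double.
have [s' [s'F s's covE]] : exists s',
    [/\ {subset s' <= pairwise_unions (finset.set0 :: F)}, seq.size s' <= uphalf (seq.size s)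
      & forall i, has (fun S : {set _} => i \in S) s -> has (fun S : {set _} => i \in S) s'].
  (* Induction on a bound for the length, as two sets are consumed at a time. *)
  have [m] := ubnP (seq.size s); elim: m s sF {st scov} => // m IHm [|A [|B s]] sF sm.
  - by exists [::].
  - exists [:: A]; split=> // T; rewrite inE => /eqP->.
    rewrite mem_pairwise_unions; apply/allpairsP; exists (A, finset.set0).
    by rewrite /= finset.setU0 !inE eqxx sF ?inE ?eqxx ?orbT.
  - have [||s' [s'F s's covE]] := IHm s.
    + by move=> T Ts; rewrite sF // !inE Ts !orbT.
    + by move: sm => /=; lia.
    exists ((A :|: B) :: s'); split=> [T|| i /=].
    + rewrite inE => /orP[/eqP->|/s'F//].
      rewrite mem_pairwise_unions; apply/allpairsP; exists (A, B).
      by rewrite /= !inE !sF ?inE ?eqxx ?orbT.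
    + by rewrite /= ltnS.
    + by rewrite inE orbA => /orP[->//|/covE->]; rewrite orbT.
exists s'; split=> //= [|i]; last exact: covE.
apply: leq_trans s's _; rewrite leq_uphalf_double; by rewrite even_halfK.
Qed.

Definition tree_reduce (j : nat) (x : tree) : tree :=
  iter j (fun y => tree_halve (tree_pad y)) (tree_min x).

Lemma polytime_tree_reduce j : polytime (tree_reduce j).
Proof.
apply: polytime_comp polytime_tree_min.
exact: (polytime_iter j (polytime_comp polytime_tree_halve polytime_tree_pad)).
Qed.

(** A round turns [t] into at most [(t + 1) / 2], so [2 ^ j * t] grows by at most [2 ^ j] in the
    round from [j] to [j.+1]. These increments stay within the term [2 ^ j] of the bound, which
    doubles. *)
Lemma tree_reduce_enc k (I : set_cover_instance k) j : 0 < k ->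
  exists I' : set_cover_instance (iter j double k),
    [/\ enc_set_cover I' = tree_reduce j (enc_set_cover I),
      sc_n I' <= sc_n I + j, 2 ^ j * sc_t I' <= sc_n I + 2 ^ j
      & has_cover I' = has_cover I].
Proof.
move=> k0; elim: j => [|j [J [encJ nJ tJ covJ]]].
  have [J [encJ nJ tJ covJ]] := tree_min_enc I.
  exists J; split=> //; first by rewrite nJ addn0.
  by rewrite tJ mul1n; apply: leq_trans (geq_minr _ _) (leq_addr _ _).
have K0 : 0 < iter j double k by elim: (j) => //= i; rewrite double_gt0.
have [J1 [enc1 n1 t1 cov1]] := tree_pad_enc J K0.
have [|J2 [enc2 n2 t2 cov2]] := @tree_halve_enc _ J1; first by rewrite t1 oddD oddb addbb.
exists J2; split; rewrite ?cov2 ?cov1 //.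
- by rewrite enc2 enc1 encJ.
- by rewrite n2 addnS; apply: leq_trans n1 _; rewrite ltnS.
- rewrite expnS t2; have : sc_t J1 <= sc_t J + 1 by rewrite t1; case: odd; lia.
  have : (sc_t J1)./2.*2 <= sc_t J1 by rewrite -[leqRHS]odd_double_half leq_addl.
  by rewrite -muln2; nia.
Qed.

(** * Polynomial-time reductions and randomized running times *)

Local Open Scope ring_scope.

(** The first [T0] coins do not influence the outcome: the bad sequences form a product with all
    prefixes, and the factor [2 ^ T0] cancels. *)
Lemma error_prob_prefix (R : realType) (p A : prog) x y T0 T b :
  (forall r : seq bool, size r = T0 -> foldl step (init (p ++ A) x) r = init A y) ->
  error_prob R (p ++ A) x (T0 + T) b = error_prob R A y T b.
Proof.
move=> pA; rewrite /error_prob.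
set E := finset _; set E' := finset _.
have runE (u : T0.-tuple bool) (v : T.-tuple bool) :
    run (p ++ A) x (cat_tuple u v) = run A y v.
  by rewrite /run /= foldl_cat pA ?size_tuple.
have -> : E = [set cat_tuple (uv : _ * _).1 uv.2 | uv in finset.setX [set: T0.-tuple bool] E'].
  apply/finset.setP => r; apply/idP/imsetP => [rE|[[u v] /finset.setXP[_ vE] ->]].
    have s1 : size (take T0 r) == T0 by rewrite size_takel // size_tuple leq_addr.
    have s2 : size (drop T0 r) == T by rewrite size_drop size_tuple addKn.
    have rE' : r = cat_tuple (Tuple s1) (Tuple s2).
      by apply: val_inj; rewrite /= cat_take_drop.
    exists (Tuple s1, Tuple s2) => //=; rewrite !inE /=.
    by move: rE; rewrite inE {1}rE' runE.
  by move: vE; rewrite !inE /= runE.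
rewrite card_imset => [|[u v] [u' v'] /= /(congr1 val)/= /eqP]; last first.
  by rewrite eqseq_cat ?size_tuple // => /andP[/eqP/val_inj-> /eqP/val_inj->].
rewrite finset.cardsX finset.cardsT !card_tuple card_bool expnD !natrM -mulf_div divff ?mul1r //.
Qed.

(** The reduction runs first, in variable 0, and leaves exactly the initial store of [A] on input
    [f x]. Its polynomial cost fits because [0 <= eps] makes the exponential factor at least 1. *)
Lemma solvable_in_reduction (R : realType) (Pi Pi' : problem)
    (par : instance Pi -> nat) (par' : instance Pi' -> nat) (f : tree -> tree)
    (eps eps' c : R) :
  polytime f -> 0 <= eps ->
  (forall I, exists I', [/\ encode I' = f (encode I), yes I' = yes I
     & eps' * (par' I')%:R <= eps * (par I)%:R + c]) ->
  solvable_in par' eps' -> solvable_in par eps.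
Proof.
move=> [P [q [cP fq]]] eps0 red [A [qA HA]].
pose C := (Num.truncn (2 `^ c : R)).+1.
exists (P 0%N ++ A), (q + C%:P * (qA \Po q)) => I.
have [I' [encI' yesI' parI']] := red I.
have [T [Tle halt err]] := HA I'.
set x := encode I; have leaf y : (0 < y)%N -> update (fun=> Leaf) 0%N x y = Leaf by case: y.
have [T0 T0le H0] := cP _ _ leaf.
have E0 (r : seq bool) : size r = T0 -> foldl step (init (P 0%N ++ A) x) r = init A (f x).
  move=> /H0 ->; congr (_, _); apply/funext => y.
  by rewrite /update; case: eqP.
exists (T0 + T)%N; split.
- have sz : input_size I = tree_size x by [].
  rewrite sz hornerD hornerM hornerC horner_comp.
  have T0le' : (T0 <= q.[tree_size x])%N by [].
  have le1 : 1 <= 2 `^ (eps * (par I)%:R) :> R.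
    by rewrite -[leLHS](powRr0 (2 : R)) ler_powR ?ler1n // mulr_ge0.
  have leC : 2 `^ c <= C%:R :> R by rewrite ltW // truncnS_gt.
  have lesz : (qA.[input_size I'] <= qA.[q.[tree_size x]])%N.
    by apply: horner_nat_le; rewrite /input_size encI'; exact: fq.
  have le2 : 2 `^ (eps' * (par' I')%:R) <= 2 `^ (eps * (par I)%:R) * C%:R :> R.
    apply: le_trans (_ : 2 `^ (eps * (par I)%:R + c) <= _); first by rewrite ler_powR ?ler1n.
    rewrite powRD; last by rewrite pnatr_eq0 implybT.
    by rewrite ler_wpM2l // powR_ge0.
  rewrite natrD -[X in _ <= _ * X%:R]/(q.[tree_size x] + C * qA.[q.[tree_size x]])%N.
  rewrite natrD natrM mulrDr.
  apply: lerD.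
    apply: le_trans (_ : (q.[tree_size x])%:R <= _); first by rewrite ler_nat.
    by rewrite ler_peMl.
  apply: le_trans Tle _; rewrite mulrA; apply: ler_pM => //.
  by rewrite ler_nat.
- move=> r; rewrite /run -(cat_take_drop T0 r) foldl_cat E0; last first.
    by rewrite size_takel // size_tuple leq_addr.
  have s2 : size (drop T0 r) == T by rewrite size_drop size_tuple addKn.
  by have := halt (Tuple s2); rewrite encI'.
- by rewrite (error_prob_prefix R _ _ E0) -encI' -yesI'.
Qed.

(** * Comparison of the exponents *)

Lemma sigma_par_n_le (R : realType) (k j : nat) (eps : R) : (0 < k)%N -> 0 < eps ->
  solvable_in (@par_nt (iter j double k)) eps ->
  (sigma R (@par_n k) <= ((1 + (2 ^+ j)^-1) * eps)%:E)%E.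
Proof.
move=> k0 eps0 solv; have d0 : 0 < 2 ^+ j :> R by rewrite exprn_gt0.
apply: ereal_inf_lbound; exists ((1 + (2 ^+ j)^-1) * eps) => //.
have pos : 0 < (1 + (2 ^+ j)^-1) * eps by rewrite mulr_gt0 // addr_gt0 // invr_gt0.
(* The constant collects [eps * j] for the elements added by padding and [eps] for the term [2 ^ j]
   in the bound on the new budget. *)
split=> //; apply: (@solvable_in_reduction _ _ _ _ _ _ _ _ (eps * j.+1%:R)
  (polytime_tree_reduce j) (ltW pos) _ solv) => I.
have [I' [encI' nI' tI' covI']] := tree_reduce_enc I j k0.
exists I'; split=> //.
have -> : (1 + (2 ^+ j)^-1) * eps * (par_n I)%:R + eps * j.+1%:R
    = eps * ((par_n I + j)%:R + (2 ^+ j)^-1 * ((par_n I)%:R + 2 ^+ j)) :> R.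
  by rewrite natrD -addn1 natrD; field; exact: lt0r_neq0.
rewrite ler_pM2l // [leLHS]natrD; apply: lerD; first by rewrite ler_nat.
rewrite ler_pdivlMl //.
by rewrite -natrX -natrM -natrD ler_nat.
Qed.

Theorem theorem18 (R : realType) :
  (limn (fun k : nat => sigma R (@par_n k))
     <= limn (fun k : nat => sigma R (@par_nt k)))%E.
Proof.
set L := limn (fun k => sigma R (@par_nt k)).
have mono_n : {homo (fun k => sigma R (@par_n k)) : k l / (k <= l)%N >-> (k <= l)%E}.
  by move=> k l kl; exact: (@sigma_widen R par_n k l kl (fun=> erefl)).
have mono_nt : {homo (fun k => sigma R (@par_nt k)) : k l / (k <= l)%N >-> (k <= l)%E}.
  by move=> k l kl; exact: (@sigma_widen R par_nt k l kl (fun=> erefl)).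
have ntL k : (sigma R (@par_nt k) <= L)%E.
  rewrite /L (cvg_lim _ (ereal_nondecreasing_cvgn mono_nt)) //.
  by apply: ereal_sup_ubound; exists k.
(* The threshold [y] is uniform in [K], so [K] may later be taken as [iter j double k.+1] with [j]
   depending on the required precision. *)
have eps_lt (K : nat) (y : \bar R) : (L < y)%E -> exists eps : R,
    [/\ 0 < eps, solvable_in (@par_nt K) eps & (eps%:E < y)%E].
  move=> /(le_lt_trans (ntL K)) /ereal_inf_lt[_ [eps [eps0 solv] <-] epsy].
  by exists eps.
rewrite (cvg_lim _ (ereal_nondecreasing_cvgn mono_n)) //.
(* Passing from [k] to [k.+1] ensures the positive set size that padding requires. *)
apply: ge_ereal_sup => _ [k _ <-]; apply: le_trans (mono_n _ _ (leqnSn k)) _.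
move: eps_lt; clear -L; case: L => [l|_|/(_ 0%N 0%E (ltNyr _))[eps [eps0 _]]] //.
- move=> eps_lt; apply/lee_addgt0Pr => e e0.
  (* With this [j], the excess [eps / 2 ^ j] is at most [e / 2] for every [eps] below
     [l + e / 2]. *)
  have [j jP] : exists j, (l + e / 2) / (e / 2) <= 2 ^+ j.
    exists (Num.truncn `|(l + e / 2) / (e / 2)|).+1; apply: le_trans (ler_norm _) _.
    apply: le_trans (ltW (truncnS_gt _)) _.
    by rewrite -natrX ler_nat ltnW // ltn_expl.
  have [|eps [eps0 solv]] := eps_lt (iter j double k.+1) (l + e / 2)%:E.
    by rewrite lte_fin ltrDl divr_gt0.
  rewrite lte_fin => epsl.
  apply: le_trans (sigma_par_n_le (ltn0Sn k) eps0 solv) _.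
  rewrite -EFinD lee_fin mulrDl mul1r [leRHS](_ : _ = (l + e / 2) + e / 2); last by field.
  apply: lerD; first exact: ltW.
  rewrite ler_pdivrMl ?exprn_gt0 //; apply: le_trans (ltW epsl) _.
  by rewrite -ler_pdivrMr // divr_gt0.
- by rewrite leey.
(* If [L] were minus infinity, some positive [eps] would be below 0. *)
- by rewrite lte_fin ltNge (ltW eps0).
Qed.
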